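(* Assume $0<A,B\le 1$ and $B\ge B_0(A)$. Let $U$ satisfy $G_{A,B}(U)=0$ and $L(A,B)\le U\le R(A,B)$. Then \[ \frac1\pi G'_{A,B}(U)\ge\sqrt{2(1+AB)}, \] equivalently \[ (A+B)\sin(\pi U)+B\kappa\sin(\pi M(U))+A\varepsilon\sin(\pi N(U))\ge\sqrt{2(1+AB)}. \]
   Context: For $0<A,B\le1$ put $\kappa=\sqrt{1-A^2}$, $\varepsilon=\sqrt{1-B^2}$, $P=P(A,B)=\frac{1+AB}{B(A+B)}$, $M(U)=\kappa(P-U)$, $N(U)=\varepsilon\left(U+\frac{\kappa^2}{A(A+B)}\right)$, and $G_{A,B}(U)=B\cos(\pi M(U))-A\cos(\pi N(U))-(A+B)\cos(\pi U)$. Further $L(A,B)=\frac{\kappa}{1+\kappa}\frac{1+AB}{B(A+B)}$, $R(A,B)=\frac{1-\varepsilon\kappa^2/[A(A+B)]}{1+\varepsilon}$, and $B_0(A)=\frac{-A(1-\kappa)+\sqrt{A^2(1-\kappa)^2+8\kappa(1+\kappa)}}{2(1+\kappa)}$. *)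

(* Defs.v *)
From Stdlib Require Import Reals.
From Coquelicot Require Import Coquelicot.
Open Scope R_scope.

Definition kap (A : R) : R := sqrt (1 - A ^ 2).
Definition eps (B : R) : R := sqrt (1 - B ^ 2).
Definition Pf (A B : R) : R := (1 + A * B) / (B * (A + B)).
Definition Mf (A B U : R) : R := kap A * (Pf A B - U).
Definition Nf (A B U : R) : R := eps B * (U + kap A ^ 2 / (A * (A + B))).
Definition G (A B U : R) : R :=
  B * cos (PI * Mf A B U) - A * cos (PI * Nf A B U) - (A + B) * cos (PI * U).
Definition Lf (A B : R) : R :=
  kap A / (1 + kap A) * ((1 + A * B) / (B * (A + B))).
Definition Rf (A B : R) : R :=
  (1 - eps B * kap A ^ 2 / (A * (A + B))) / (1 + eps B).
Definition B0 (A : R) : R :=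
  (- A * (1 - kap A) + sqrt (A ^ 2 * (1 - kap A) ^ 2 + 8 * kap A * (1 + kap A)))
  / (2 * (1 + kap A)).

(* Main.v *)
(** Put [k = kap A], [e = eps B], [V = 1 - U], [Q = (1 + A B) / (A (A + B))], so
    that [N = e (Q - V)] mirrors [M = k (P - U)]: exchanging [(A, B, U)] and
    [(B, A, 1 - U)] maps [G] to [-G] and preserves the claim, so [U <= 1/2] may
    be assumed.  The condition [B0 A <= B] says [L <= 1/2]; after squaring it is
    symmetric in [A] and [B], hence it also says [R >= 1/2].
    Let [p, q, c] be the cosines at [M, N, U] and [S] the left-hand side.
    Using [B p - A q = (A + B) c], the claim [S^2 >= 2 (1 + A B)] reduces to
    [2 (A + B) sin u (B k sin a + A e sin b)
       >= 2 k^2 e^2 + (B p - A q)^2 + B^2 k^2 p^2 + A^2 e^2 q^2],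
    with [a, b, u] the angles [PI M, PI N, PI U].
    Since [P - U >= 1/2], concavity of the sine gives [p <= A^2], hence
    [c <= 1/2] and [U >= 1/3]; the [k sin a] term then absorbs the [k^2] terms
    and the [e sin b] term absorbs the others. *)
Require Import Defs.
From Stdlib Require Import Reals Rtrigo_facts Lra Psatz.
From Coquelicot Require Import Coquelicot.
Open Scope R_scope.

(** * Chord bounds from the concavity of the sine *)

(** The mean value theorem on [[0, l x]] and [[l x, x]] compares the two slopes, since the cosine
    decreases on [[0, PI]]. *)
Lemma sin_scale_ge (l x : R) :
  0 <= l <= 1 -> 0 <= x <= PI -> l * sin x <= sin (l * x).
Proof.
  intros [Hl0 Hl1] [Hx0 Hx1].
  destruct (Req_dec l 0) as [->|Hl]; [rewrite !Rmult_0_l, sin_0; lra|].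
  destruct (Req_dec l 1) as [->|Hl']; [rewrite !Rmult_1_l; lra|].
  destruct (Req_dec x 0) as [->|Hx]; [rewrite !Rmult_0_r, sin_0; lra|].
  assert (H1 : 0 < l * x) by nra.
  assert (H2 : l * x < x) by nra.
  destruct (MVT_cor2 sin cos 0 (l * x) H1 (fun c _ => derivable_pt_lim_sin c))
    as [y [Ey Hy]].
  destruct (MVT_cor2 sin cos (l * x) x H2 (fun c _ => derivable_pt_lim_sin c))
    as [z [Ez Hz]].
  rewrite sin_0 in Ey.
  assert (Hyz : cos z <= cos y) by (apply cos_decr_1; lra).
  assert (0 <= l * ((1 - l) * x) * (cos y - cos z)).
  { apply Rmult_le_pos; [|lra]. repeat apply Rmult_le_pos; lra. }
  nra.
Qed.

Lemma sin_PI_ge (x : R) : 0 <= x <= 1 / 2 -> 2 * x <= sin (PI * x).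
Proof.
  intros Hx. pose proof PI_RGT_0.
  generalize (sin_scale_ge (2 * x) (PI / 2) ltac:(lra) ltac:(lra)).
  rewrite sin_PI2. replace (2 * x * (PI / 2)) with (PI * x) by field. lra.
Qed.

(** Halve the angle and use the chord of the sine up to [PI / 4], where [2 sin^2 = 1]. *)
Lemma cos_PI2_le (x : R) : 0 <= x <= 1 -> cos (PI * (x / 2)) <= 1 - x ^ 2.
Proof.
  intros Hx. pose proof PI_RGT_0.
  generalize (sin_scale_ge x (PI / 4) ltac:(lra) ltac:(lra)).
  replace (PI * (x / 2)) with (2 * (x * (PI / 4))) by field.
  rewrite cos_2a_sin. intros H1.
  assert (H2 : 2 * (sin (PI / 4) * sin (PI / 4)) = 1).
  { generalize (cos_2a_sin (PI / 4)).
    replace (2 * (PI / 4)) with (PI / 2) by field. rewrite cos_PI2. lra. }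
  assert (0 < sin (PI / 4)) by (apply sin_gt_0; lra).
  assert (0 <= x * sin (PI / 4)) by (apply Rmult_le_pos; lra).
  assert ((x * sin (PI / 4)) ^ 2 <= sin (x * (PI / 4)) ^ 2)
    by (apply pow_incr; lra).
  nra.
Qed.

(* Equivalent to [tan (PI x / 2) <= 2 x]. *)
Lemma one_minus_cos_le (x : R) :
  0 <= x <= 1 / 2 -> 1 - cos (PI * x) <= 2 * x * sin (PI * x).
Proof.
  intros Hx. pose proof PI_RGT_0.
  set (y := PI * (x / 2)).
  replace (PI * x) with (2 * y) by (unfold y; field).
  assert (Hy0 : 0 <= y) by (unfold y; nra).
  assert (Hy1 : y <= PI / 4) by (unfold y; nra).
  rewrite cos_2a_sin, sin_2a.
  (* The chord bound at [PI / 4 - y] yields [1 - 2 x <= cos y - sin y]; multiplying the left side by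
     [cos y <= 1] then gives [sin y <= 2 x cos y]. *)
  generalize (sin_scale_ge (1 - 2 * x) (PI / 4) ltac:(lra) ltac:(lra)).
  replace ((1 - 2 * x) * (PI / 4)) with (PI / 4 - y) by (unfold y; field).
  rewrite sin_minus, cos_PI4, <- sin_PI4. intros H1.
  assert (0 < sin (PI / 4)) by (apply sin_gt_0; lra).
  assert (H2 : 1 - 2 * x <= cos y - sin y)
    by (apply (Rmult_le_reg_l (sin (PI / 4))); lra).
  assert (0 <= sin y) by (apply sin_ge_0; lra).
  assert (cos y <= 1) by apply COS_bound.
  assert (0 <= (1 - 2 * x) * (1 - cos y)) by (apply Rmult_le_pos; lra).
  assert (sin y <= 2 * x * cos y) by lra.
  nra.
Qed.

(** * The squared estimate on the half [U <= 1 / 2] *)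

(** [k], [e], [P], [Q] stay free so that the mirrored case is another instance.
    [e * (Q - 1 / 2) <= 1 / 2] encodes [R >= 1 / 2], and [k * (P - U) <= U] encodes [L <= U]. *)
Lemma slope_sq_ge (A B k e P Q U : R) :
  0 < A <= 1 -> 0 < B <= 1 -> 0 <= k -> 0 <= e ->
  k ^ 2 = 1 - A ^ 2 -> e ^ 2 = 1 - B ^ 2 ->
  P * (B * (A + B)) = 1 + A * B -> Q * (A * (A + B)) = 1 + A * B ->
  e * (Q - 1 / 2) <= 1 / 2 ->
  0 <= U <= 1 / 2 -> k * (P - U) <= U ->
  B * cos (PI * (k * (P - U))) - A * cos (PI * (e * (Q - (1 - U))))
    = (A + B) * cos (PI * U) ->
  2 * (1 + A * B) <=
  ((A + B) * sin (PI * U) + B * k * sin (PI * (k * (P - U)))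
   + A * e * sin (PI * (e * (Q - (1 - U))))) ^ 2.
Proof.
  intros HA HB Hk He Hk2 He2 HP HQ HN2 HU HMU HG.
  pose proof PI_RGT_0 as Hpi.
  assert (Hk1 : k <= 1) by nra.
  assert (He1 : e <= 1) by nra.
  assert (HAB : 0 < A * B) by nra.
  assert (HP1 : 1 <= P).
  { apply (Rmult_le_reg_r (B * (A + B))); nra. }
  assert (HQ1 : 1 <= Q).
  { apply (Rmult_le_reg_r (A * (A + B))); nra. }
  set (M := k * (P - U)) in *. set (N := e * (Q - (1 - U))) in *.
  assert (HMk : k / 2 <= M) by (unfold M; nra).
  assert (HNle : N <= e * (Q - 1 / 2)) by (unfold N; nra).
  assert (Hp : cos (PI * M) <= A ^ 2).
  { apply Rle_trans with (cos (PI * (k / 2))).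
    - apply cos_decr_1; nra.
    - generalize (cos_PI2_le k ltac:(lra)). lra. }
  assert (Hp0 : 0 <= cos (PI * M)) by (apply cos_ge_0; nra).
  assert (HX : 2 * M <= sin (PI * M)) by (apply sin_PI_ge; lra).
  assert (HN0 : 0 <= N) by (unfold N; apply Rmult_le_pos; lra).
  assert (Hq0 : 0 <= cos (PI * N)) by (apply cos_ge_0; nra).
  assert (Hc0 : 0 <= cos (PI * U)) by (apply cos_ge_0; nra).
  assert (HBp : B * cos (PI * M) <= A ^ 2 * B) by nra.
  assert (Hc : cos (PI * U) <= 1 / 2).
  { apply (Rmult_le_reg_l (A + B)); [lra|].
    assert (A ^ 2 * B <= A * B) by nra. nra. }
  assert (HU3 : 1 / 3 <= U).
  { destruct (Rle_lt_dec (1 / 3) U) as [h|h]; [exact h|exfalso].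
    assert (cos (PI / 3) < cos (PI * U)) by (apply cos_decreasing_1; nra).
    rewrite cos_PI3 in H. lra. }
  assert (Hs0 : 0 <= sin (PI * U)) by (apply sin_ge_0; nra).
  generalize (sin2_cos2 (PI * U)) (sin2_cos2 (PI * M)) (sin2_cos2 (PI * N)).
  unfold Rsqr. intros Es EX EY.
  (* [866 / 1000] lies just below [sqrt 3 / 2 = sin (PI / 3)]. *)
  assert (Hs : 866 / 1000 <= sin (PI * U)) by nra.
  (* [N >= e / 3] because [Q >= 1] and [U >= 1 / 3]; then the chord bound applies at [PI / 3]. *)
  assert (HY : 866 / 1000 * e <= sin (PI * N)).
  { apply Rle_trans with (sin (PI * (e / 3))).
    - generalize (sin_scale_ge e (PI / 3) ltac:(lra) ltac:(lra)).
      replace (e * (PI / 3)) with (PI * (e / 3)) by field.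
      assert (866 / 1000 <= sin (PI / 3)).
      { assert (0 <= sin (PI / 3)) by (apply sin_ge_0; lra).
        generalize (sin2_cos2 (PI / 3)). unfold Rsqr. rewrite cos_PI3. nra. }
      nra.
    - assert (e / 3 <= N) by (unfold N; nra).
      apply sin_incr_1; nra. }
  generalize (one_minus_cos_le N ltac:(lra)).
  intros Hq1.
  assert (Hq : cos (PI * N) <= 1) by apply COS_bound.
  assert (HMP : k * (P - 1 / 2) <= M) by (unfold M; nra).
  clearbody M N.
  set (p := cos (PI * M)) in *. set (q := cos (PI * N)) in *.
  set (c := cos (PI * U)) in *. set (s := sin (PI * U)) in *.
  set (X := sin (PI * M)) in *. set (Y := sin (PI * N)) in *.
  clearbody p q c s X Y.
  assert (HX0 : 0 <= X) by lra.
  assert (HY0 : 0 <= Y) by nra.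
  assert (HAeY : 0 <= A * e * Y) by (repeat apply Rmult_le_pos; lra).
  (* The left side is at most [k^2 (2 - B^2)], while [X >= 2 M >= 2 k (P - 1 / 2)] and [2 s >= 1]
     bound the right side below. *)
  assert (T1 : 2 * k ^ 2 * e ^ 2 + B ^ 2 * k ^ 2 * p ^ 2
               <= 2 * (A + B) * s * (B * k * X)).
  { assert (E : 2 * k ^ 2 * e ^ 2 + B ^ 2 * k ^ 2 * p ^ 2
                <= k ^ 2 * (2 - B ^ 2)).
    { rewrite He2. assert (p ^ 2 <= 1) by nra.
      assert (0 <= B ^ 2 * k ^ 2) by nra. nra. }
    assert (F : k * (2 + A * B - B ^ 2) <= B * (A + B) * X).
    { replace (k * (2 + A * B - B ^ 2))
        with (B * (A + B) * (2 * (k * (P - 1 / 2)))).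
      - apply Rmult_le_compat_l; [nra|lra].
      - replace (B * (A + B) * (2 * (k * (P - 1 / 2))))
          with (k * (2 * (P * (B * (A + B))) - B * (A + B))) by field.
        rewrite HP. ring. }
    assert (F0 : 0 <= B * (A + B) * X) by (apply Rmult_le_pos; nra).
    assert (F1 : k * (2 - B ^ 2) <= 2 * s * (B * (A + B) * X)) by nra.
    assert (k * (k * (2 - B ^ 2)) <= k * (2 * s * (B * (A + B) * X)))
      by (apply Rmult_le_compat_l; lra).
    lra. }
  assert (T2 : (B * p - A * q) ^ 2 + A ^ 2 * e ^ 2 * q ^ 2
               <= 2 * (A + B) * s * (A * e * Y)).
  { assert (Hd0 : 0 <= B * p - A * q) by nra.
    (* One factor is bounded by [A^2 B], the other by [A (1 - q)], which is controlled by [e Y]. *)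
    assert (Hd1 : (B * p - A * q) ^ 2 <= A ^ 2 * B * (A * (1 - q))).
    { assert (A ^ 2 * B <= A) by nra.
      assert (B * p - A * q <= A ^ 2 * B) by nra.
      assert (B * p - A * q <= A * (1 - q)) by nra.
      replace ((B * p - A * q) ^ 2) with ((B * p - A * q) * (B * p - A * q)) by ring.
      apply Rmult_le_compat; lra. }
    assert (Hd2 : A * (1 - q) <= A * (2 * (e * (Q - 1 / 2)) * Y)) by
      (apply Rmult_le_compat_l; nra).
    assert (Hd3 : A ^ 2 * B * (A * (1 - q))
                  <= A ^ 2 * B * (A * (2 * (e * (Q - 1 / 2)) * Y)))
      by (apply Rmult_le_compat_l; [nra|lra]).
    (* [1155 / 1000] exceeds the reciprocal of [866 / 1000]. *)
    assert (Hd4 : A ^ 2 * e ^ 2 * q ^ 2 <= (A * e * Y) * (1155 / 1000 * A)).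
    { assert (q ^ 2 <= 1) by nra.
      assert (0 <= A ^ 2 * e ^ 2) by nra.
      assert (A ^ 2 * e * e <= A ^ 2 * e * (1155 / 1000 * Y))
        by (apply Rmult_le_compat_l; nra).
      nra. }
    (* With the previous bound the total coefficient of [A e Y] is at most [1.655 A + B], below
       [1.732 (A + B) <= 2 (A + B) s]. *)
    assert (Hd5 : A * (2 * A * B * (Q - 1 / 2)) <= 1 / 2 * A + B).
    { apply (Rmult_le_reg_l (A + B)); [lra|].
      replace ((A + B) * (A * (2 * A * B * (Q - 1 / 2))))
        with (2 * (A * B) * (Q * (A * (A + B))) - A ^ 2 * B * (A + B)) by field.
      rewrite HQ.
      assert (4 * (A * B) <= (A + B) * (A + B))
        by (pose proof (pow2_ge_0 (A - B)); lra).
      assert (2 * (A * B) * (1 + A * B) <= (A + B) * (A + B) / 2 * (1 + A * B))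
        by (apply Rmult_le_compat_r; lra).
      assert (A * B <= 1) by nra.
      assert (0 <= (A + B) * B * ((1 - A * B) + A * A))
        by (repeat apply Rmult_le_pos; nra).
      lra. }
    assert (A * e * Y * (A * (2 * A * B * (Q - 1 / 2)) + 1155 / 1000 * A)
            <= A * e * Y * (2 * (A + B) * s))
      by (apply Rmult_le_compat_l; nra).
    lra. }
  assert (T3 : 0 <= 2 * (B * k * X) * (A * e * Y)).
  { assert (0 <= B * k * X) by (repeat apply Rmult_le_pos; lra). nra. }
  assert (Es' : (A + B) ^ 2 * s ^ 2 = (A + B) ^ 2 - (B * p - A * q) ^ 2)
    by (rewrite HG; replace (s ^ 2) with (1 - c * c) by lra; ring).
  assert (EX' : X ^ 2 = 1 - p ^ 2) by lra.
  assert (EY' : Y ^ 2 = 1 - q ^ 2) by lra.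
  replace (((A + B) * s + B * k * X + A * e * Y) ^ 2)
    with ((A + B) ^ 2 * s ^ 2 + B ^ 2 * k ^ 2 * X ^ 2 + A ^ 2 * e ^ 2 * Y ^ 2
          + 2 * (A + B) * s * (B * k * X) + 2 * (A + B) * s * (A * e * Y)
          + 2 * (B * k * X) * (A * e * Y)) by ring.
  rewrite Es', EX', EY'.
  (* This splitting cancels the leading squares, leaving the sum of [T1], [T2] and [T3]. *)
  assert (2 * (1 + A * B) = (A + B) ^ 2 + B ^ 2 * k ^ 2 + A ^ 2 * e ^ 2
            + 2 * k ^ 2 * e ^ 2) by (rewrite Hk2, He2; ring).
  lra.
Qed.

(** * The threshold [B0] and its symmetry *)

(** [B0 A] is the larger root of [(1 + k) B^2 + A (1 - k) B - 2 k], and the conclusion says that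
    this quadratic is nonnegative, that is, [L <= 1 / 2]. *)
Lemma half_condition_of_B0_le (A B : R) :
  0 < A <= 1 -> 0 < B -> B0 A <= B ->
  kap A * (2 + A * B - B ^ 2) <= B * (A + B).
Proof.
  intros HA HB. unfold B0.
  assert (Hk : 0 <= kap A) by apply sqrt_pos.
  set (k := kap A) in *. clearbody k.
  set (D := A ^ 2 * (1 - k) ^ 2 + 8 * k * (1 + k)).
  intros H.
  apply (Rmult_le_compat_r (2 * (1 + k))) in H; [|lra].
  unfold Rdiv in H. rewrite Rmult_assoc, Rinv_l, Rmult_1_r in H by lra.
  assert (HD : 0 <= D).
  { unfold D. apply Rplus_le_le_0_compat.
    - apply Rmult_le_pos; apply pow2_ge_0.
    - repeat apply Rmult_le_pos; lra. }
  assert (H1 : sqrt D ^ 2 <= (2 * (1 + k) * B + A * (1 - k)) ^ 2)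
    by (apply pow_incr; split; [apply sqrt_pos | lra]).
  rewrite pow2_sqrt in H1 by exact HD. unfold D in H1.
  apply (Rmult_le_reg_l (4 * (1 + k))); [lra|]. lra.
Qed.

(* Squared, the hypothesis reads
   [4 + 4 s + 4 s^2 + 2 s^3 <= (2 + s)^2 (A^2 + B^2)] with [s = A B]. *)
Lemma half_condition_sym (A B k e : R) :
  0 < A <= 1 -> 0 < B <= 1 -> 0 <= k -> 0 <= e ->
  k ^ 2 = 1 - A ^ 2 -> e ^ 2 = 1 - B ^ 2 ->
  k * (2 + A * B - B ^ 2) <= B * (A + B) ->
  e * (2 + B * A - A ^ 2) <= A * (B + A).
Proof.
  intros HA HB Hk He Hk2 He2 H.
  assert (H1 : (k * (2 + A * B - B ^ 2)) ^ 2 <= (B * (A + B)) ^ 2)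
    by (apply pow_incr; split; [apply Rmult_le_pos; nra | exact H]).
  apply Rsqr_incr_0_var; [|nra]. rewrite !Rsqr_pow2.
  rewrite Rpow_mult_distr, He2. rewrite Rpow_mult_distr, Hk2 in H1. lra.
Qed.

(** * Reduction to one half and the derivative *)

Lemma slope_ge (A B U : R) :
  0 < A <= 1 -> 0 < B <= 1 -> B0 A <= B ->
  G A B U = 0 -> Lf A B <= U <= Rf A B ->
  sqrt (2 * (1 + A * B)) <=
  (A + B) * sin (PI * U) + B * kap A * sin (PI * Mf A B U)
    + A * eps B * sin (PI * Nf A B U).
Proof.
  intros HA HB HB0 HG [HL HR].
  pose proof PI_RGT_0 as Hpi.
  assert (Hk2 : kap A ^ 2 = 1 - A ^ 2) by (apply pow2_sqrt; nra).
  assert (He2 : eps B ^ 2 = 1 - B ^ 2) by (apply pow2_sqrt; nra).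
  assert (Hk : 0 <= kap A) by apply sqrt_pos.
  assert (He : 0 <= eps B) by apply sqrt_pos.
  pose proof (half_condition_of_B0_le A B HA (proj1 HB) HB0) as Hhk.
  pose proof (half_condition_sym A B _ _ HA HB Hk He Hk2 He2 Hhk) as Hhe.
  set (Q := (1 + A * B) / (A * (A + B))).
  assert (HP : Pf A B * (B * (A + B)) = 1 + A * B) by (unfold Pf; field; lra).
  assert (HQ : Q * (A * (A + B)) = 1 + A * B) by (unfold Q; field; lra).
  assert (HQ' : kap A ^ 2 / (A * (A + B)) = Q - 1)
    by (rewrite Hk2; unfold Q; field; lra).
  assert (HN : Nf A B U = eps B * (Q - (1 - U)))
    by (unfold Nf; rewrite HQ'; ring).
  assert (HP1 : 1 <= Pf A B) by (apply (Rmult_le_reg_r (B * (A + B))); nra).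
  assert (HQ1 : 1 <= Q) by (apply (Rmult_le_reg_r (A * (A + B))); nra).
  (* Cleared of denominators, [L <= U] is [M <= U] and [U <= R] is [N <= 1 - U]. *)
  assert (HMU : kap A * (Pf A B - U) <= U).
  { unfold Lf in HL. fold (Pf A B) in HL.
    apply (Rmult_le_compat_r (1 + kap A)) in HL; [|lra].
    replace (kap A / (1 + kap A) * Pf A B * (1 + kap A))
      with (kap A * Pf A B) in HL by (field; lra). lra. }
  assert (HNV : eps B * (Q - (1 - U)) <= 1 - U).
  { unfold Rf in HR.
    replace (eps B * kap A ^ 2 / (A * (A + B))) with (eps B * (Q - 1)) in HR
      by (rewrite <- HQ'; unfold Rdiv; ring).
    apply (Rmult_le_compat_r (1 + eps B)) in HR; [|lra].
    unfold Rdiv in HR. rewrite Rmult_assoc, Rinv_l in HR by lra. lra. }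
  assert (HM2 : kap A * (Pf A B - 1 / 2) <= 1 / 2).
  { apply (Rmult_le_reg_r (B * (A + B))); [nra|].
    replace (kap A * (Pf A B - 1 / 2) * (B * (A + B)))
      with (kap A * (Pf A B * (B * (A + B)) - B * (A + B) / 2)) by field.
    rewrite HP. lra. }
  assert (HN2 : eps B * (Q - 1 / 2) <= 1 / 2).
  { apply (Rmult_le_reg_r (A * (A + B))); [nra|].
    replace (eps B * (Q - 1 / 2) * (A * (A + B)))
      with (eps B * (Q * (A * (A + B)) - A * (A + B) / 2)) by field.
    rewrite HQ. lra. }
  assert (HU0 : 0 <= U) by nra.
  assert (HU1 : U <= 1) by nra.
  unfold G in HG. rewrite HN in *. unfold Mf in *.
  assert (HM0 : 0 <= kap A * (Pf A B - U)) by (apply Rmult_le_pos; lra).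
  assert (HN0 : 0 <= eps B * (Q - (1 - U))) by (apply Rmult_le_pos; lra).
  assert (HS : 2 * (1 + A * B) <=
     ((A + B) * sin (PI * U) + B * kap A * sin (PI * (kap A * (Pf A B - U)))
      + A * eps B * sin (PI * (eps B * (Q - (1 - U))))) ^ 2).
  { destruct (Rle_lt_dec U (1 / 2)) as [h|h].
    - apply slope_sq_ge; auto; lra.
    (* Reflection keeps the sine and negates the cosine, so the mirrored equation is [G = 0] with
       its sign reversed. *)
    - assert (EV : PI * (1 - U) = PI - PI * U) by ring.
      assert (EU : 1 - (1 - U) = U) by ring.
      generalize (slope_sq_ge B A (eps B) (kap A) Q (Pf A B) (1 - U)).
      rewrite EU, EV, sin_PI_x, cos_pi_minus,
        (Rmult_comm B A), (Rplus_comm B A).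
      intros H.
      replace ((A + B) * sin (PI * U) + B * kap A * sin (PI * (kap A * (Pf A B - U)))
               + A * eps B * sin (PI * (eps B * (Q - (1 - U)))))
        with ((A + B) * sin (PI * U)
              + A * eps B * sin (PI * (eps B * (Q - (1 - U))))
              + B * kap A * sin (PI * (kap A * (Pf A B - U)))) by ring.
      apply H; auto; lra. }
  rewrite <- (sqrt_pow2 ((A + B) * sin (PI * U)
    + B * kap A * sin (PI * (kap A * (Pf A B - U)))
    + A * eps B * sin (PI * (eps B * (Q - (1 - U)))))).
  - apply sqrt_le_1_alt, HS.
  - assert (0 <= sin (PI * U)) by (apply sin_ge_0; nra).
    assert (0 <= sin (PI * (kap A * (Pf A B - U)))) by (apply sin_ge_0; nra).
    assert (0 <= sin (PI * (eps B * (Q - (1 - U))))) by (apply sin_ge_0; nra).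
    repeat apply Rplus_le_le_0_compat; repeat apply Rmult_le_pos; lra.
Qed.

Lemma is_derive_G (A B U : R) :
  is_derive (G A B) U
    (PI * ((A + B) * sin (PI * U) + B * kap A * sin (PI * Mf A B U)
           + A * eps B * sin (PI * Nf A B U))).
Proof.
  unfold G, Mf, Nf, Rminus.
  generalize (kap A ^ 2 / (A * (A + B))). intros d.
  auto_derive; [easy | ring].
Qed.

Theorem theorem1p3 (A B U : R) :
  0 < A <= 1 -> 0 < B <= 1 -> B0 A <= B ->
  G A B U = 0 -> Lf A B <= U <= Rf A B ->
  ex_derive (G A B) U /\
  / PI * Derive (G A B) U >= sqrt (2 * (1 + A * B)) /\
  (A + B) * sin (PI * U) + B * kap A * sin (PI * Mf A B U)
    + A * eps B * sin (PI * Nf A B U) >= sqrt (2 * (1 + A * B)).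
Proof.
  intros HA HB HB0 HG HU.
  pose proof (slope_ge A B U HA HB HB0 HG HU) as HS.
  split; [eexists; apply is_derive_G|].
  rewrite (is_derive_unique _ _ _ (is_derive_G A B U)).
  rewrite <- Rmult_assoc, Rinv_l, Rmult_1_l by apply PI_neq0.
  split; apply Rle_ge, HS.
Qed.
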